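(* Let $\Omega\subset\mathbb{R}^n$, $n\ge 2$, be a bounded simply connected domain with $C^2$ boundary, let $\sigma_0\in L^\infty(\Omega)$ be a real-valued function with $0<K_1<\sigma_0<K_2$ for positive constants $K_1,K_2$, and let $\beta\in\mathbb{R}$ with $\beta\neq 1$. Let $\mathbf{J}_0,\tilde{\mathbf{J}}_0\in (L^2(\Omega))^n$ be compactly supported in $\Omega$, let $u_0,\tilde u_0\in H^1(\Omega)$ be the corresponding potentials, and let $$\mathbf{A}=\beta\sigma_0\nabla u_0-\mathbf{J}_0,\qquad \tilde{\mathbf{A}}=\beta\sigma_0\nabla \tilde u_0-\tilde{\mathbf{J}}_0$$ be the corresponding internal functionals, so that $\mathbf{J}_0$ and $\tilde{\mathbf{J}}_0$ are the currents reconstructed from $\mathbf{A}$ and $\tilde{\mathbf{A}}$. Then $$\|\mathbf{J}_0-\tilde{\mathbf{J}}_0\|_{(L^2(\Omega))^n}\le\left(1+\frac{|\beta|K_2}{|\beta-1|K_1}\right)\|\mathbf{A}-\tilde{\mathbf{A}}\|_{(L^2(\Omega))^n}.$$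
   Context: For a current $\mathbf{J}_0\in(L^2(\Omega))^n$ compactly supported in $\Omega$, the corresponding potential $u_0\in H^1(\Omega)$ is the weak solution, unique up to an additive constant, of $$\nabla\cdot\sigma_0\nabla u_0=\nabla\cdot\mathbf{J}_0\ \text{ in }\Omega,\qquad \frac{\partial u_0}{\partial n}=0\ \text{ on }\partial\Omega,$$ that is, $\int_\Omega\sigma_0\nabla u_0\cdot\nabla\phi\,dx=\int_\Omega\mathbf{J}_0\cdot\nabla\phi\,dx$ for all $\phi\in H^1(\Omega)$. Likewise $\tilde u_0$ is the potential corresponding to $\tilde{\mathbf{J}}_0$. The internal functional $\mathbf{A}=\beta\sigma_0\nabla u_0-\mathbf{J}_0$ does not depend on the additive constant in $u_0$. Reconstruction of $\mathbf{J}_0$ from $\mathbf{A}$ (for $\beta\ne1$): since $\nabla\cdot\mathbf{J}_0=\frac{1}{\beta-1}\nabla\cdot\mathbf{A}$, one solves (weakly, up to an additive constant) $\nabla\cdot\sigma_0\nabla u_0=\frac{1}{\beta-1}\nabla\cdot\mathbf{A}$ in $\Omega$ with $\frac{\partial u_0}{\partial n}=0$ on $\partial\Omega$, i.e. $\int_\Omega\sigma_0\nabla u_0\cdot\nabla\phi\,dx=\frac{1}{\beta-1}\int_\Omega\mathbf{A}\cdot\nabla\phi\,dx$ for all $\phi\in H^1(\Omega)$, and sets $\mathbf{J}_0=\beta\sigma_0\nabla u_0-\mathbf{A}$. *)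

(* Defs.v *)
From HB Require Import structures.
From mathcomp Require Import all_boot all_order all_algebra.
From mathcomp Require Import all_classical all_reals all_analysis.
From mathcomp Require Import measurable_realfun.

Set Implicit Arguments.
Unset Strict Implicit.
Unset Printing Implicit Defensive.

Import Order.TTheory GRing.Theory Num.Theory.
Import numFieldNormedType.Exports.

Local Open Scope classical_set_scope.
Local Open Scope ring_scope.

(* The points of R^n are the row vectors 'rV[R]_n.  They carry the sigma-algebra
   generated by the coordinate functions, which is the Borel one
   (open_measurable_rV). *)
Definition rV_display : measure_display. Proof. exact. Qed.

Section measurable_rV.
Context {R : realType} (n : nat).

Let coord (i : 'I_n) (x : 'rV[R]_n) : R := x 0 i.

Let rV_set0 : g_sigma_preimage coord set0.
Proof. exact: sigma_algebra0. Qed.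

Let rV_setC A : g_sigma_preimage coord A -> g_sigma_preimage coord (~` A).
Proof. exact: sigma_algebraC. Qed.

Let rV_bigcup (F : _^nat) : (forall i, g_sigma_preimage coord (F i)) ->
  g_sigma_preimage coord (\bigcup_i (F i)).
Proof. exact: sigma_algebra_bigcup. Qed.

HB.instance Definition _ := @isMeasurable.Build rV_display
  'rV[R]_n (g_sigma_preimage coord) rV_set0 rV_setC rV_bigcup.

End measurable_rV.

Section measurable_rV_theory.
Context {R : realType}.

Lemma measurable_rV_coord n (i : 'I_n) :
  measurable_fun [set: 'rV[R]_n] (fun x : 'rV[R]_n => x 0 i).
Proof.
move=> _ Y mY; rewrite setTI; apply: sub_sigma_algebra => /=.
rewrite -bigcup_seq/=; exists i => /=; first by rewrite mem_index_enum.
by exists Y => //; rewrite setTI.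
Qed.

Lemma measurable_fun_rVP d (T : measurableType d) n (f : T -> 'rV[R]_n) :
  (forall i, measurable_fun [set: T] (fun t => f t 0 i)) ->
  measurable_fun [set: T] f.
Proof.
move=> mf.
suff sub : (@measurable _ 'rV[R]_n) `<=` image_set_system [set: T] f measurable.
  by move=> _ A mA; exact: sub.
apply: smallest_sub.
  by apply: sigma_algebra_image; exact: sigma_algebra_measurable.
move=> A /=; rewrite -bigcup_seq => -[i _ [B mB <-]].
rewrite /image_set_system /= !setTI -[X in measurable X]setTI.
exact: mf.
Qed.

Lemma open_measurable_rV n (A : set 'rV[R]_n) : open A -> measurable A.
Proof.
move=> oA.
pose c (q : 'rV[rat]_n) : 'rV[R]_n := map_mx ratr q.
pose B (p : 'rV[rat]_n * nat) : set 'rV[R]_n :=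
  [set x | forall i, ball (c p.1 0 i) p.2.+1%:R^-1 (x 0 i)].
have mB p : measurable (B p).
  have -> : B p = \big[setI/setT]_(i < n)
      ((fun x : 'rV[R]_n => x 0 i) @^-1` ball (c p.1 0 i) p.2.+1%:R^-1).
    rewrite -bigcap_seq; apply/seteqP; split => x /= Bx i.
      by move=> _; exact: Bx.
    by apply: (Bx i); rewrite /= mem_index_enum.
  apply: bigsetI_measurable => i _; rewrite -[X in measurable X]setTI.
  by apply: measurable_rV_coord => //; exact: measurable_ball.
have -> : A = \bigcup_(p in [set p | B p `<=` A]) B p.
  apply/seteqP; split => [x Ax|x [p /= pA Bx]]; last exact: pA.
  have := open_nbhs_nbhs (conj oA Ax); rewrite -nbhs_ballE => -[e /= e0 eA].
  pose k := Num.truncn (2 / e).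
  have ke : k.+1%:R^-1 < e / 2 :> R.
    by rewrite -[ltRHS]invrK ltf_pV2 ?posrE ?invr_gt0 ?divr_gt0// invf_div
      truncnS_gt.
  have k0 : 0 < k.+1%:R^-1 :> R by rewrite invr_gt0.
  have /choice[q qP] i : exists q : rat, ball (x 0 i) k.+1%:R^-1 (ratr q).
    have [|q] := @rat_in_itvoo R (x 0 i - k.+1%:R^-1) (x 0 i + k.+1%:R^-1).
      by rewrite ltrBlDr -addrA ltrDl addr_gt0.
    by rewrite in_itv/= => qi; exists q; rewrite ball_itv/= in_itv.
  have xB : B (\row_i q i, k) x.
    by move=> i /=; rewrite !mxE; apply: ball_sym; exact: qP.
  exists (\row_i q i, k) => // y /= yB; apply: eA; split => // i j.
  rewrite (ord1 i) (splitr e).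
  apply: (@ball_triangle _ _ (c (\row_i q i) 0 j)).
    by apply: ball_sym; apply: le_ball (xB j); exact: ltW.
  by apply: le_ball (yB j); exact: ltW.
rewrite bigcup_mkcond; apply: countable_bigcupT_measurable => // p.
by case: ifP.
Qed.

End measurable_rV_theory.

(* Lebesgue measure on R^n, as the iterated product of the one-dimensional one:
   the measure on R^n.+1 is the image of lebesgue_measure \x (the measure on R^n)
   by the bijection rV_cons. *)
Section lebesgue_rV.
Context {R : realType}.

Definition rV_cons n (p : measurableTypeR R * 'rV[R]_n) : 'rV[R]_n.+1 :=
  \row_i oapp (fun j => p.2 0 j) p.1 (unlift ord0 i).

Definition rV_uncons n (x : 'rV[R]_n.+1) : measurableTypeR R * 'rV[R]_n :=
  (x 0 ord0, \row_j x 0 (lift ord0 j)).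

Lemma rV_consK n : cancel (@rV_cons n) (@rV_uncons n).
Proof.
case=> a x; congr pair; rewrite ?mxE ?unlift_none//=.
by apply/rowP => j; rewrite !mxE liftK.
Qed.

Lemma measurable_rV_cons n : measurable_fun setT (@rV_cons n).
Proof.
apply: measurable_fun_rVP => i.
under eq_fun do rewrite mxE.
case: (unliftP ord0 i) => [j _|_] /=; last exact: measurable_fst.
by apply: (measurableT_comp (measurable_rV_coord j)); exact: measurable_snd.
Qed.

Lemma measurable_rV_uncons n : measurable_fun setT (@rV_uncons n).
Proof.
apply: measurable_fun_pair; first exact: measurable_rV_coord.
apply: measurable_fun_rVP => j; under eq_fun do rewrite mxE.
exact: measurable_rV_coord.
Qed.

Section step.
Context n (mu : {sigma_finite_measure set 'rV[R]_n -> \bar R}).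

Definition rV_product : set 'rV[R]_n.+1 -> \bar R :=
  pushforward (lebesgue_measure \x mu)%E (@rV_cons n).

Let rV_product0 : rV_product set0 = 0%E.
Proof. by rewrite /rV_product /pushforward preimage_set0 measure0. Qed.

Let rV_product_ge0 A : (0 <= rV_product A)%E.
Proof. by rewrite /rV_product /pushforward measure_ge0. Qed.

Let rV_product_sigma_additive : semi_sigma_additive rV_product.
Proof.
have mf := @measurable_rV_cons n.
move=> F mF tF mUF; rewrite /rV_product /pushforward preimage_bigcup.
apply: measure_semi_sigma_additive.
- by move=> k; rewrite -[X in measurable X]setTI; exact: mf.
- apply/trivIsetP => /= i j _ _ ij; rewrite -preimage_setI.
  by move/trivIsetP : tF => /(_ _ _ _ _ ij) ->//; rewrite preimage_set0.
- by rewrite -preimage_bigcup -[X in measurable X]setTI; exact: mf.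
Qed.

HB.instance Definition _ := isMeasure.Build _ _ _ rV_product
  rV_product0 rV_product_ge0 rV_product_sigma_additive.

Let rV_product_sigma_finite : sigma_finite [set: 'rV[R]_n.+1] rV_product.
Proof.
have /sigma_finiteP[F [TF ndF Foo]] := sigma_finiteT (@lebesgue_measure R).
have /sigma_finiteP[G [TG ndG Goo]] := sigma_finiteT mu.
exists (fun k => @rV_uncons n @^-1` (F k `*` G k)).
  rewrite -preimage_bigcup; apply/esym/seteqP; split => // x _.
  have [i _ Fi] : (\bigcup_i F i) (rV_uncons x).1 by rewrite -TF.
  have [j _ Gj] : (\bigcup_i G i) (rV_uncons x).2 by rewrite -TG.
  exists (maxn i j) => //; split.
    by move: Fi; exact/subsetPset/ndF/leq_maxl.
  by move: Gj; exact/subsetPset/ndG/leq_maxr.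
move=> k; have [mF Fk] := Foo k; have [mG Gk] := Goo k; split.
  rewrite -[X in measurable X]setTI; apply: measurable_rV_uncons => //.
  exact: measurableX.
rewrite /rV_product /pushforward -comp_preimage.
rewrite (_ : _ \o _ = id); last by apply/funext => p /=; rewrite rV_consK.
by rewrite preimage_id product_measure1E// lte_mul_pinfty// ge0_fin_numE.
Qed.

HB.instance Definition _ := Measure_isSigmaFinite.Build _ _ _ rV_product
  rV_product_sigma_finite.

End step.

Fixpoint lebesgue_rV n : {sigma_finite_measure set 'rV[R]_n -> \bar R} :=
  if n is m.+1 then [the {sigma_finite_measure set _ -> \bar R} of
                     rV_product (lebesgue_rV m)]
  else [the {sigma_finite_measure set _ -> \bar R} of @dirac _ 'rV[R]_0 0 R].

Lemma lebesgue_rV_box n (A : 'I_n -> set R) :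
  (forall i, measurable (A i)) ->
  lebesgue_rV n [set x | forall i, A i (x 0 i)] =
  (\prod_(i < n) @lebesgue_measure R (A i))%E.
Proof.
pose box m (B : 'I_m -> set R) := [set x : 'rV[R]_m | forall i, B i (x 0 i)].
have mbox m (B : 'I_m -> set R) : (forall i, measurable (B i)) ->
    measurable (box m B).
  move=> mB; have -> : box m B = \big[setI/setT]_(i < m)
      ((fun x : 'rV[R]_m => x 0 i) @^-1` B i).
    rewrite -bigcap_seq; apply/seteqP; split => x /= Bx i.
      by move=> _; exact: Bx.
    by apply: (Bx i); rewrite /= mem_index_enum.
  apply: bigsetI_measurable => i _; rewrite -[X in measurable X]setTI.
  exact: measurable_rV_coord.
elim: n A => [|n IH] A mA.
  by rewrite big_ord0 /= diracE mem_set// => -[].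
rewrite big_ord_recl -IH; last by move=> i; exact: mA.
rewrite [LHS]/= /rV_product /pushforward.
rewrite -product_measure1E//; [|exact: mA|]; last first.
  by apply: (mbox n (fun i => A (lift ord0 i))) => i; exact: mA.
congr (_ _); apply/seteqP; split => -[a x] /=.
  move=> h; split=> [|i] /=.
    by have := h ord0; rewrite mxE unlift_none.
  by have := h (lift ord0 i); rewrite mxE liftK.
by move=> [/= ha hx] i; rewrite mxE; case: (unliftP ord0 i) => [j ->|->] /=.
Qed.

End lebesgue_rV.

Section geometry.
Context {R : realType}.

(* The library norm on 'rV[R]_n is the sup norm; the Euclidean one is needed for
   the norm of (L^2)^n. *)
Definition dotv n (x y : 'rV[R]_n) : R := \sum_i x 0 i * y 0 i.
Definition enorm n (x : 'rV[R]_n) : R := Num.sqrt (dotv x x).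

Definition partial n (i : 'I_n) (f : 'rV[R]_n -> R) : 'rV[R]_n -> R :=
  'D_(delta_mx 0 i) f.

Fixpoint Ck n (k : nat) (f : 'rV[R]_n -> R) : Prop :=
  continuous f /\
  if k is k'.+1 then
    forall i, (forall x, derivable f x (delta_mx 0 i)) /\ Ck k' (partial i f)
  else True.

Definition boundary n (Omega : set 'rV[R]_n) := closure Omega `\` Omega^°.

(* Near each boundary point, in a suitable orthonormal coordinate system
   y = x *m Q, Omega is the part strictly above the graph y_i = g y' of a C^k
   function of the other coordinates y' = col' i y. *)
Definition Ck_boundary n (k : nat) (Omega : set 'rV[R]_n) :=
  forall x0 : 'rV[R]_n, boundary Omega x0 ->
    exists (i : 'I_n) (Q : 'M[R]_n) (g : 'rV[R]_n.-1 -> R),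
      [/\ Q *m Q^T = 1%:M, Ck k g &
          \forall x \near x0,
            Omega x <-> g (col' i (x *m Q)) < (x *m Q) 0 i].

Definition path_in n (Omega : set 'rV[R]_n) (p : R -> 'rV[R]_n) :=
  {within `[0, 1], continuous p} /\ (forall t : R, `[0, 1]%classic t -> Omega (p t)).

Definition simply_connected n (Omega : set 'rV[R]_n) :=
  (forall x y, Omega x -> Omega y ->
     exists p, [/\ path_in Omega p, p 0 = x & p 1 = y]) /\
  (forall p, path_in Omega p -> p 0 = p 1 ->
     exists H : R * R -> 'rV[R]_n,
       [/\ {within `[0, 1] `*` `[0, 1], continuous H},
           forall s t : R, `[0, 1]%classic s -> `[0, 1]%classic t ->
             Omega (H (s, t)),
           forall t : R, `[0, 1]%classic t -> H (0, t) = p t,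
           forall t : R, `[0, 1]%classic t -> H (1, t) = p 0 &
           forall s : R, `[0, 1]%classic s -> H (s, 0) = p 0 /\ H (s, 1) = p 0]).

End geometry.

(* Elements of L^2(Omega), L^oo(Omega) and (L^2(Omega))^n are represented by
   functions on R^n of which only the restriction to Omega matters. *)
Section function_spaces.
Context {R : realType} (n : nat) (Omega : set 'rV[R]_n).
Local Notation mu := (lebesgue_rV n).

Definition L2 (f : 'rV[R]_n -> R) := f \_ Omega \in Lfun mu 2%:E.

Definition Loo (f : 'rV[R]_n -> R) := f \_ Omega \in Lfun mu +oo%E.

Definition L2v (F : 'rV[R]_n -> 'rV[R]_n) := forall i, L2 (fun x => F x 0 i).

Definition L2v_norm (F : 'rV[R]_n -> 'rV[R]_n) : \bar R :=
  'N[mu]_2%:E [EFin \o ((fun x => enorm (F x)) \_ Omega)].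

(* The essential support of F is a compact subset of Omega. *)
Definition compactly_supported (F : 'rV[R]_n -> 'rV[R]_n) :=
  exists K : set 'rV[R]_n, [/\ compact K, K `<=` Omega &
    {ae mu, forall x, Omega x -> ~ K x -> F x = 0}].

Definition test_function (phi : 'rV[R]_n -> R) :=
  [/\ forall k, Ck k phi, compact (closure [set x | phi x != 0]) &
      closure [set x | phi x != 0] `<=` Omega].

(* u is in H^1(Omega) with weak gradient Du (which is unique almost everywhere
   in Omega). *)
Definition H1 (u : 'rV[R]_n -> R) (Du : 'rV[R]_n -> 'rV[R]_n) :=
  [/\ L2 u, L2v Du &
      forall phi i, test_function phi ->
        \int[mu]_(x in Omega) (u x * partial i phi x) =
        - \int[mu]_(x in Omega) (Du x 0 i * phi x)].

(* u, with gradient Du, is a weak solution of div (sigma grad u) = div F in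
   Omega, with homogeneous Neumann boundary condition. *)
Definition neumann_solution (sigma : 'rV[R]_n -> R)
    (F : 'rV[R]_n -> 'rV[R]_n) (u : 'rV[R]_n -> R)
    (Du : 'rV[R]_n -> 'rV[R]_n) :=
  H1 u Du /\
  forall phi Dphi, H1 phi Dphi ->
    \int[mu]_(x in Omega) (sigma x * dotv (Du x) (Dphi x)) =
    \int[mu]_(x in Omega) dotv (F x) (Dphi x).

Definition internal_functional (beta : R) (sigma : 'rV[R]_n -> R)
    (Du J : 'rV[R]_n -> 'rV[R]_n) : 'rV[R]_n -> 'rV[R]_n :=
  fun x => (beta * sigma x) *: Du x - J x.

(* Solving the Neumann problem with right-hand side A / (beta - 1) is possible,
   and beta sigma grad v - A is J for every solution v. *)
Definition reconstructed_from (beta : R) (sigma : 'rV[R]_n -> R)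
    (A J : 'rV[R]_n -> 'rV[R]_n) :=
  let F x := (beta - 1)^-1 *: A x in
  (exists v Dv, neumann_solution sigma F v Dv) /\
  (forall v Dv, neumann_solution sigma F v Dv ->
     {ae mu, forall x, Omega x -> J x = (beta * sigma x) *: Dv x - A x}).

End function_spaces.

(* Main.v *)
Require Import Defs.
From mathcomp Require Import all_boot all_order all_algebra.
From mathcomp Require Import all_classical all_reals all_analysis.
From mathcomp Require Import measurable_realfun ring lra.

Set Implicit Arguments.
Unset Strict Implicit.
Unset Printing Implicit Defensive.

Import Order.TTheory GRing.Theory Num.Theory.
Import numFieldNormedType.Exports.

Local Open Scope classical_set_scope.
Local Open Scope ring_scope.

(* Testing the equation of u with v gives <A, grad v> = (beta - 1) <sigma grad u,
   grad v>, so u also solves the Neumann problem with right-hand side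
   A / (beta - 1), and coercivity makes its gradient unique.  For the stability
   estimate let w, a, j be the differences of the gradients, functionals and
   currents.  Testing with u - u' gives
     |beta - 1| K1 ||w||^2 <= |beta - 1| <sigma w, w> = |<a, w>| <= ||a|| ||w||,
   and j = beta sigma w - a yields
     ||j|| <= |beta| K2 ||w|| + ||a||. *)

(** * Square-integrable functions on a measurable subset of a measure space *)

Section square_integrable.
Context d (T : measurableType d) (R : realType).
Context (mu : {measure set T -> \bar R}) (D : set T) (mD : measurable D).
Implicit Types f g s : T -> R.

Let restrictE f x : (f \_ D) x ^+ 2 = ((fun x => f x ^+ 2) \_ D) x.
Proof. by rewrite !patchE; case: ifP => //; rewrite expr0n. Qed.

(** Trades the norm of the zero extension for integrability of the square on [D], so that the
    closure properties below reduce to integrability. *)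
Lemma Lfun2_restrictP f : f \_ D \in Lfun mu 2%:E <->
  measurable_fun D f /\ mu.-integrable D (EFin \o (fun x => f x ^+ 2)).
Proof.
split => [f2|[mf if2]].
  split.
    apply/(measurable_restrictT f mD).
    by move: f2; rewrite inE => /andP[+ _]; rewrite inE.
  apply/(integrable_mkcond _ mD); rewrite restrict_EFin.
  have := Lfun2_integrable_sqr f2.
  by apply: eq_integrable => // x _ /=; rewrite restrictE.
rewrite inE; apply/andP; split.
  by rewrite inE/=; apply/(measurable_restrictT f mD).
rewrite inE/= /finite_norm unlock; apply: poweR_lty.
move/(integrable_mkcond _ mD) : if2; rewrite restrict_EFin => /integrableP[_].
congr (_ < _)%E; apply: eq_integral => x _ /=.
rewrite -restrictE powR_mulrn//.
by rewrite ger0_norm ?sqr_ge0// real_normK ?num_real.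
Qed.

Lemma Lfun2_restrictM f g :
  f \_ D \in Lfun mu 2%:E -> g \_ D \in Lfun mu 2%:E ->
  mu.-integrable D (EFin \o (fun x => f x * g x)).
Proof.
move=> f2 g2; apply/(integrable_mkcond _ mD); rewrite restrict_EFin.
have /Lfun1_integrable := Lfun2_mul_Lfun1 f2 g2.
apply: eq_integrable => // x _ /=; congr EFin.
by rewrite !patchE; case: ifP => //; rewrite mulr0.
Qed.

(** Expand the square: the cross term [2 * (f * g)] is integrable by [Lfun2_restrictM]. *)
Lemma Lfun2_restrictD f g :
  f \_ D \in Lfun mu 2%:E -> g \_ D \in Lfun mu 2%:E ->
  (fun x => f x + g x) \_ D \in Lfun mu 2%:E.
Proof.
move=> f2 g2; have fg := Lfun2_restrictM f2 g2.
move/Lfun2_restrictP : f2 => [mf if2]; move/Lfun2_restrictP : g2 => [mg ig2].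
apply/Lfun2_restrictP; split; first exact: measurable_funD.
have := integrableD mD (integrableD mD if2 ig2) (integrableZl mD 2 fg).
apply: eq_integrable => // x _ /=; congr EFin; ring.
Qed.

Lemma integrable_ae_boundedM s f (K : R) : measurable_fun D s ->
  {ae mu, forall x, D x -> `|s x| <= K} ->
  mu.-integrable D (EFin \o f) ->
  mu.-integrable D (EFin \o (fun x => s x * f x)).
Proof.
move=> ms sK /integrableP[/measurable_EFinP mf foo]; apply/integrableP; split.
  by apply/measurable_EFinP; exact: measurable_funM.
(* The sign of [K] is not known (it may be negative when [D] is negligible), so the nonnegative
   majorant is built with the absolute value of [K]. *)
apply: (@le_lt_trans _ _ (\int[mu]_(x in D) (`|K| * `|f x|)%:E)%E).
  apply: ae_ge0_le_integral => //.
  - apply/measurable_EFinP; apply: measurableT_comp => //.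
    exact: measurable_funM.
  - apply/measurable_EFinP; apply: measurable_funM => //.
    exact: measurableT_comp.
  - apply: filterS sK => x /[apply] sxK.
    rewrite lee_fin normrM ler_wpM2r//.
    by rewrite (le_trans sxK)// ler_norm.
under eq_integral do rewrite EFinM.
rewrite ge0_integralZl//; last first.
  by apply/measurable_EFinP; exact: measurableT_comp.
by rewrite lte_mul_pinfty.
Qed.

Lemma Lfun2_restrict_ae_boundedM s f (K : R) : measurable_fun D s ->
  {ae mu, forall x, D x -> `|s x| <= K} ->
  f \_ D \in Lfun mu 2%:E -> (fun x => s x * f x) \_ D \in Lfun mu 2%:E.
Proof.
move=> ms sK /Lfun2_restrictP[mf if2]; apply/Lfun2_restrictP; split.
  exact: measurable_funM.
have sK2 : {ae mu, forall x, D x -> `|s x ^+ 2| <= K ^+ 2}.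
  apply: filterS sK => x /[apply] sxK.
  by rewrite normrX lerXn2r ?nnegrE// (le_trans _ sxK).
have := integrable_ae_boundedM (measurable_funX 2 ms) sK2 if2.
by apply: eq_integrable => // x _ /=; rewrite exprMn.
Qed.

Lemma Lfun2_restrictZ (c : R) f : f \_ D \in Lfun mu 2%:E ->
  (fun x => c * f x) \_ D \in Lfun mu 2%:E.
Proof. by apply: (@Lfun2_restrict_ae_boundedM _ _ `|c|) => //; exact: aeW. Qed.

Lemma bounded_Lfun2_restrict f : (mu D < +oo)%E -> measurable_fun D f ->
  [bounded f x | x in D] -> f \_ D \in Lfun mu 2%:E.
Proof.
move=> Doo mf bf; apply/Lfun2_restrictP; split => //.
have := integrableMr mD mf bf (measurable_bounded_integrable mD Doo mf bf).
by apply: eq_integrable => // x _ /=; rewrite expr2.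
Qed.

(** The difference [g - f] coincides almost everywhere with its absolute value, whose integral is
    nonnegative. *)
Lemma ae_le_Rintegral f g :
  mu.-integrable D (EFin \o f) -> mu.-integrable D (EFin \o g) ->
  {ae mu, forall x, D x -> f x <= g x} ->
  \int[mu]_(x in D) f x <= \int[mu]_(x in D) g x.
Proof.
move=> if_ ig fg; rewrite -subr_ge0 -RintegralB//.
have /integrableP[mh _] := integrableB mD ig if_.
have -> : \int[mu]_(x in D) (g x - f x) = \int[mu]_(x in D) `|g x - f x|.
  congr fine; apply: ae_eq_integral => //.
    apply/measurable_EFinP; apply: measurableT_comp => //.
    exact/measurable_EFinP.
  by apply: filterS fg => x /[apply] fg; rewrite ger0_norm// subr_ge0.
by apply: Rintegral_ge0.
Qed.

(** Integrability excludes an infinite integral, which [fine] would also send to 0; the integral of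
    the absolute value of [f] is then really 0. *)
Lemma Rintegral_eq0_ae f : mu.-integrable D (EFin \o f) ->
  (forall x, D x -> 0 <= f x) -> \int[mu]_(x in D) f x = 0 ->
  {ae mu, forall x, D x -> f x = 0}.
Proof.
move=> if_ f0 int0.
have [mf _] := integrableP _ _ _ if_.
have : (\int[mu]_(x in D) `|(EFin \o f) x| = 0)%E.
  rewrite -[RHS](congr1 EFin int0) /Rintegral fineK ?integrable_fin_num//.
  by apply: eq_integral => x /set_mem Dx /=; rewrite ger0_norm ?f0.
move/(ae_eq_integral_abs mu mD mf); apply: filterS => x /[apply] /=.
by case.
Qed.

End square_integrable.

(** * Bilinearity and definiteness of the Euclidean dot product *)

Section dotv_theory.
Context {R : realType} (n : nat).
Implicit Types x y z : 'rV[R]_n.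

Lemma dotvC x y : dotv x y = dotv y x.
Proof. by apply: eq_bigr => i _; rewrite mulrC. Qed.

Lemma dotvDl x y z : dotv (x + y) z = dotv x z + dotv y z.
Proof. by rewrite -big_split; apply: eq_bigr => i _; rewrite mxE mulrDl. Qed.

Lemma dotvZl c x y : dotv (c *: x) y = c * dotv x y.
Proof. by rewrite mulr_sumr; apply: eq_bigr => i _; rewrite mxE mulrA. Qed.

Lemma dotvv_ge0 x : 0 <= dotv x x.
Proof. by apply: sumr_ge0 => i _; rewrite -expr2 sqr_ge0. Qed.

Lemma dotvv_eq0 x : dotv x x = 0 -> x = 0.
Proof.
move=> /eqP; rewrite psumr_eq0 => [/allP x0|i _]; last by rewrite -expr2 sqr_ge0.
apply/rowP => i; rewrite mxE; apply/eqP.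
by have := x0 i (mem_index_enum _); rewrite mulf_eq0 orbb.
Qed.

End dotv_theory.

(** * The inner product and norm of (L^2(Omega))^n, with real values *)

Section inner_product.
Context {R : realType} (n : nat) (Omega : set 'rV[R]_n).
Hypothesis mOmega : measurable Omega.
Local Notation mu := (lebesgue_rV n).
Implicit Types F G H : 'rV[R]_n -> 'rV[R]_n.

Definition inner F G : R := \int[mu]_(x in Omega) dotv (F x) (G x).

Lemma integrable_dotv F G : L2v Omega F -> L2v Omega G ->
  mu.-integrable Omega (EFin \o (fun x => dotv (F x) (G x))).
Proof.
move=> F2 G2.
have := @integrable_sum _ _ _ mu _ mOmega _ (index_enum 'I_n) xpredT
  (fun i x => (F x 0 i * G x 0 i)%:E).
have -> : (fun x => \sum_(i < n) (F x 0 i * G x 0 i)%:E)%E =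
  EFin \o (fun x => dotv (F x) (G x)) by apply/funext => x; rewrite sumEFin.
apply=> i _; exact: Lfun2_restrictM (F2 i) (G2 i).
Qed.

Lemma L2vD F G : L2v Omega F -> L2v Omega G -> L2v Omega (fun x => F x + G x).
Proof.
move=> F2 G2 i; rewrite /L2; under [X in X \_ _]eq_fun do rewrite mxE.
exact: Lfun2_restrictD (F2 i) (G2 i).
Qed.

Lemma L2vZ c F : L2v Omega F -> L2v Omega (fun x => c *: F x).
Proof.
move=> F2 i; rewrite /L2; under [X in X \_ _]eq_fun do rewrite mxE.
exact: Lfun2_restrictZ (F2 i).
Qed.

Lemma L2vN F : L2v Omega F -> L2v Omega (fun x => - F x).
Proof.
by move=> /(L2vZ (-1)); under eq_fun do rewrite scaleN1r.
Qed.

Lemma L2vB F G : L2v Omega F -> L2v Omega G -> L2v Omega (fun x => F x - G x).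
Proof. by move=> F2 G2; apply: L2vD => //; exact: L2vN. Qed.

Lemma L2v_ae_boundedZ (s : 'rV[R]_n -> R) (K : R) F :
  measurable_fun Omega s -> {ae mu, forall x, Omega x -> `|s x| <= K} ->
  L2v Omega F -> L2v Omega (fun x => s x *: F x).
Proof.
move=> ms sK F2 i; rewrite /L2; under [X in X \_ _]eq_fun do rewrite mxE.
exact: (Lfun2_restrict_ae_boundedM mOmega ms sK (F2 i)).
Qed.

Lemma innerC F G : inner F G = inner G F.
Proof. by apply: eq_Rintegral => x _; rewrite dotvC. Qed.

Lemma innerDl F G H : L2v Omega F -> L2v Omega G -> L2v Omega H ->
  inner (fun x => F x + G x) H = inner F H + inner G H.
Proof.
move=> F2 G2 H2; rewrite -RintegralD//; try exact: integrable_dotv.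
by apply: eq_Rintegral => x _; rewrite dotvDl.
Qed.

Lemma innerZl c F G : L2v Omega F -> L2v Omega G ->
  inner (fun x => c *: F x) G = c * inner F G.
Proof.
move=> F2 G2; rewrite -RintegralZl//; last exact: integrable_dotv.
by apply: eq_Rintegral => x _; rewrite dotvZl.
Qed.

Lemma innerBl F G H : L2v Omega F -> L2v Omega G -> L2v Omega H ->
  inner (fun x => F x - G x) H = inner F H - inner G H.
Proof.
move=> F2 G2 H2; rewrite innerDl//; last exact: L2vN.
have -> : (fun x => - G x) = (fun x => -1 *: G x).
  by apply/funext => x; rewrite scaleN1r.
by rewrite innerZl// mulN1r.
Qed.

Lemma innerDr F G H : L2v Omega F -> L2v Omega G -> L2v Omega H ->
  inner H (fun x => F x + G x) = inner H F + inner H G.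
Proof. by move=> *; rewrite innerC innerDl// !(innerC H). Qed.

Lemma innerZr c F G : L2v Omega F -> L2v Omega G ->
  inner F (fun x => c *: G x) = c * inner F G.
Proof. by move=> *; rewrite innerC innerZl// innerC. Qed.

Lemma inner_ge0 F : 0 <= inner F F.
Proof. by apply: Rintegral_ge0 => x _; exact: dotvv_ge0. Qed.

Lemma inner_eq0_ae F : L2v Omega F -> inner F F = 0 ->
  {ae mu, forall x, Omega x -> F x = 0}.
Proof.
move=> F2 FF0.
have := Rintegral_eq0_ae mOmega (integrable_dotv F2 F2)
  (fun x _ => dotvv_ge0 (F x)) FF0.
by apply: filterS => x /[apply]; exact: dotvv_eq0.
Qed.

Definition normL2 F : R := Num.sqrt (inner F F).

Lemma normL2_ge0 F : 0 <= normL2 F.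
Proof. exact: sqrtr_ge0. Qed.

Lemma sqr_normL2 F : normL2 F ^+ 2 = inner F F.
Proof. by rewrite sqr_sqrtr// inner_ge0. Qed.

(** Carries the extended-real norm over to the real one, where the estimates are done. *)
Lemma L2v_normE F : L2v Omega F -> L2v_norm Omega F = (normL2 F)%:E.
Proof.
move=> F2; rewrite /L2v_norm /normL2 -powR12_sqrt ?inner_ge0// unlock.
rewrite -poweR_EFin /inner /Rintegral fineK; last first.
  by apply: integrable_fin_num => //; exact: integrable_dotv.
congr (_ `^ _)%E; rewrite [RHS]integral_mkcond; apply: eq_integral => x _ /=.
rewrite powR_mulrn// real_normK ?num_real// !patchE.
case: ifP => _; last by rewrite expr0n.
by rewrite sqr_sqrtr// dotvv_ge0.
Qed.

(** The classical argument: the squared norm of [F + t G] is a polynomial of degree at most 2 in [t]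
    that never becomes negative. *)
Lemma cauchy_schwarz F G : L2v Omega F -> L2v Omega G ->
  `|inner F G| <= normL2 F * normL2 G.
Proof.
move=> F2 G2.
set a := inner F F; set b := inner F G; set c := inner G G.
have quad t : 0 <= a + 2 * t * b + t ^+ 2 * c.
  have := inner_ge0 (fun x => F x + t *: G x).
  have tG2 := L2vZ t G2; have FtG2 := L2vD F2 tG2.
  rewrite innerDl// !innerDr// !innerZl// !innerZr// [inner G F]innerC.
  by congr (_ <= _); rewrite -/a -/b -/c; ring.
have a0 : 0 <= a := inner_ge0 F.
have c0 : 0 <= c := inner_ge0 G.
have bac : b ^+ 2 <= a * c.
  have [cz|cn0] := eqVneq c 0.
    have b0 : b = 0.
      apply/eqP/negP => /negP bn0.
      (* With [c = 0] the polynomial is affine in [t]; this [t] gives it the value -1. *)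
      have := quad (- (a + 1) / (2 * b)); rewrite cz mulr0 addr0.
      have -> : 2 * (- (a + 1) / (2 * b)) * b = - (a + 1) by field.
      by lra.
    by rewrite b0 cz mulr0 expr0n.
  have cp : 0 < c by rewrite lt_neqAle eq_sym cn0.
  (* The minimum point of the quadratic. *)
  have := quad (- b / c).
  have -> : a + 2 * (- b / c) * b + (- b / c) ^+ 2 * c = (a * c - b ^+ 2) / c.
    by field.
  by rewrite pmulr_lge0 ?invr_gt0// subr_ge0.
rewrite /normL2 -sqrtrM// -sqrtr_sqr.
exact: ler_wsqrtr.
Qed.

(** Compare squares, bounding [inner F G] from below by Cauchy-Schwarz. *)
Lemma normL2B_le F G : L2v Omega F -> L2v Omega G ->
  normL2 (fun x => F x - G x) <= normL2 F + normL2 G.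
Proof.
move=> F2 G2; have N2 := L2vN G2; have S2 := L2vD F2 N2.
rewrite -(@ler_pXn2r _ 2)// ?nnegrE ?addr_ge0 ?normL2_ge0//.
have := cauchy_schwarz F2 G2; rewrite ler_norml => /andP[h _].
have E : inner (fun x => F x - G x) (fun x => F x - G x) =
    inner F F - 2 * inner F G + inner G G.
  by rewrite innerBl//; rewrite !(innerC _ (fun x => F x - G x)) !innerBl//;
    rewrite (innerC G F); ring.
rewrite sqrrD !sqr_normL2 E -mulr_natl.
lra.
Qed.

Lemma normL2Z c F : L2v Omega F -> normL2 (fun x => c *: F x) = `|c| * normL2 F.
Proof.
move=> F2; have cF2 := L2vZ c F2.
by rewrite /normL2 innerZl// innerZr// mulrA -expr2 sqrtrM ?sqr_ge0// sqrtr_sqr.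
Qed.

Lemma normL2_ae_boundedZ (s : 'rV[R]_n -> R) (K : R) F :
  0 <= K ->
  measurable_fun Omega s -> {ae mu, forall x, Omega x -> `|s x| <= K} ->
  L2v Omega F -> normL2 (fun x => s x *: F x) <= K * normL2 F.
Proof.
move=> K0 ms sK F2; have sF2 := L2v_ae_boundedZ ms sK F2.
rewrite -(@ler_pXn2r _ 2)// ?nnegrE ?mulr_ge0 ?normL2_ge0//.
rewrite exprMn !sqr_normL2 -innerZl//; apply: ae_le_Rintegral => //.
- exact: integrable_dotv.
- by apply: integrable_dotv => //; exact: L2vZ.
- apply: filterS sK => x /[apply] sxK.
  rewrite dotvZl dotvC dotvZl mulrA -expr2 dotvZl ler_wpM2r ?dotvv_ge0//.
  by rewrite -real_normK ?num_real// lerXn2r ?nnegrE.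
Qed.

(** Integrate the pointwise inequality between [K] times [dotv (F x) (F x)] and [s x] times it; the
    upper bound [K'] makes the weighted integrand integrable. *)
Lemma inner_ae_coercive (s : 'rV[R]_n -> R) (K K' : R) F :
  measurable_fun Omega s -> {ae mu, forall x, Omega x -> `|s x| <= K'} ->
  {ae mu, forall x, Omega x -> K <= s x} ->
  L2v Omega F -> K * inner F F <= inner (fun x => s x *: F x) F.
Proof.
move=> ms sK' sK F2; have sF2 := L2v_ae_boundedZ ms sK' F2.
rewrite -innerZl//; apply: ae_le_Rintegral => //.
- by apply: integrable_dotv => //; exact: L2vZ.
- exact: integrable_dotv.
- apply: filterS sK => x /[apply] sxK.
  by rewrite !dotvZl ler_wpM2r ?dotvv_ge0.
Qed.

End inner_product.

(** * Continuous functions are square-integrable on bounded measurable sets *)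

Section bounded_domain.
Context {R : realType} (n : nat).

(** Open intervals generate the Borel sets of the line, and their preimages are open, hence
    measurable by [open_measurable_rV]. *)
Lemma continuous_measurable_rV (f : 'rV[R]_n -> R) : continuous f ->
  measurable_fun [set: 'rV[R]_n] f.
Proof.
move=> cf; apply: (measurability _ (RGenOpens.measurableE R)).
move=> _ [_ [a [b ->] <-]]; rewrite setTI.
apply: open_measurable_rV; apply: open_comp; last exact: interval_open.
by move=> x _; exact: cf.
Qed.

(** Bounded sets are enclosed in such cubes for two reasons: a cube is compact, so continuous
    functions are bounded on it, and it is a box, so its measure is a finite product of lengths. *)
Let cube (M : R) : set 'rV[R]_n := [set x | forall i, `[- M, M]%classic (x 0 i)].

Let compact_cube M : compact (cube M).
Proof.
apply: (@rV_compact _ _ (fun=> `[- M, M]%classic)) => _.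
exact: segment_compact.
Qed.

Let measurable_cube M : measurable (cube M).
Proof.
rewrite -[cube M]setCK; apply: measurableC; apply: open_measurable_rV.
apply: closed_openC; apply: compact_closed; last exact: compact_cube.
exact: norm_hausdorff.
Qed.

Let bounded_sub_cube (A : set 'rV[R]_n) : bounded_set A ->
  exists M, A `<=` cube M.
Proof.
(* [bounded_set] provides every bound strictly above [M], hence [M + 1]. Coordinates are controlled
   because the norm is the sup norm. *)
move=> [M [_ AM]]; exists (M + 1) => x Ax i; rewrite /= in_itv/= -ler_norml.
apply: le_trans (AM (M + 1) _ x Ax); last by rewrite ltrDl.
rewrite [leRHS]/Num.norm /= mx_normrE.
by apply/bigmax_geP; right => /=; exists (0, i).
Qed.

Lemma lebesgue_rV_bounded (A : set 'rV[R]_n) : measurable A -> bounded_set A ->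
  (lebesgue_rV n A < +oo)%E.
Proof.
move=> mA /bounded_sub_cube[M AM].
apply: (@le_lt_trans _ _ (lebesgue_rV n (cube M))).
  by apply: le_measure; rewrite ?inE.
rewrite (@lebesgue_rV_box _ _ (fun=> `[- M, M]%classic))//.
rewrite -ge0_fin_numE; last by apply: prode_ge0.
apply: prode_fin_num => i _.
by rewrite lebesgue_measure_itv/=; case: ifP.
Qed.

Lemma continuous_L2 (Omega : set 'rV[R]_n) (f : 'rV[R]_n -> R) :
  measurable Omega -> bounded_set Omega -> continuous f -> L2 Omega f.
Proof.
move=> mO bO cf; apply: bounded_Lfun2_restrict => //.
- exact: lebesgue_rV_bounded.
- by apply: measurable_funTS; exact: continuous_measurable_rV.
have [K OK] := bounded_sub_cube bO.
have := continuous_compact (continuous_subspaceT cf) (@compact_cube K).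
move/compact_bounded => [M [Mr h]]; exists M; split => // y My x Ox.
by apply: h => //; exists x => //; exact: OK.
Qed.

End bounded_domain.

(** * Weak gradients and the weighted Neumann problem *)

Section neumann.
Context {R : realType} (n : nat) (Omega : set 'rV[R]_n).
Hypotheses (mOmega : measurable Omega) (bOmega : bounded_set Omega).
Local Notation mu := (lebesgue_rV n).

(* Products with test functions are integrable because Omega is bounded:
   continuous functions are then in L2. *)
Lemma H1B u v Du Dv : H1 Omega u Du -> H1 Omega v Dv ->
  H1 Omega (fun x => u x - v x) (fun x => Du x - Dv x).
Proof.
move=> [u2 Du2 Duw] [v2 Dv2 Dvw]; split.
- rewrite /L2; have -> : (fun x => u x - v x) = (fun x => u x + -1 * v x).
    by apply/funext => x; rewrite mulN1r.
  by apply: Lfun2_restrictD => //; exact: Lfun2_restrictZ.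
- exact: L2vB.
move=> phi i tphi; have [Cphi _ _] := tphi.
have phi2 : L2 Omega phi by apply: continuous_L2 => //; have [] := Cphi 0%N.
have dphi2 : L2 Omega (partial i phi).
  by apply: continuous_L2 => //; have [_ /(_ i)[_ []]] := Cphi 1%N.
under eq_Rintegral do rewrite mulrBl.
rewrite RintegralB//; [|exact: Lfun2_restrictM..].
rewrite Duw// Dvw// -opprD; congr (- _).
under [in RHS]eq_Rintegral do rewrite !mxE mulrBl.
by rewrite RintegralB//;
  [exact: Lfun2_restrictM (Du2 i) phi2|exact: Lfun2_restrictM (Dv2 i) phi2].
Qed.

Section weighted.
Context (sigma : 'rV[R]_n -> R) (K1 K2 : R).
Hypotheses (msigma : measurable_fun Omega sigma) (K1_gt0 : 0 < K1)
  (sigma_bounds :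
    {ae mu, forall x, Omega x -> K1 < sigma x /\ sigma x < K2}).

Let normr_sigma_le : {ae mu, forall x, Omega x -> `|sigma x| <= K2}.
Proof.
apply: filterS sigma_bounds => x /[apply] -[K1s sK2].
by rewrite gtr0_norm ?(lt_trans K1_gt0)// ltW.
Qed.

Lemma L2v_sigmaZ F : L2v Omega F -> L2v Omega (fun x => sigma x *: F x).
Proof. exact: L2v_ae_boundedZ normr_sigma_le. Qed.

(** The weak formulation in terms of [inner], with the weight moved into the left argument. *)
Lemma neumann_solutionE F u Du v Dv :
  neumann_solution Omega sigma F u Du -> H1 Omega v Dv ->
  inner Omega (fun x => sigma x *: Du x) Dv = inner Omega F Dv.
Proof.
move=> [_ sol] /sol; rewrite [inner _ F _]/inner => <-.
apply: eq_Rintegral => x _.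
by rewrite dotvZl.
Qed.

Lemma neumann_solutionB F G u Du v Dv :
  L2v Omega F -> L2v Omega G ->
  neumann_solution Omega sigma F u Du -> neumann_solution Omega sigma G v Dv ->
  neumann_solution Omega sigma (fun x => F x - G x)
    (fun x => u x - v x) (fun x => Du x - Dv x).
Proof.
move=> F2 G2 solu solv; have [Hu _] := solu; have [Hv _] := solv.
split=> [|phi Dphi Hphi]; first exact: H1B.
have [_ Du2 _] := Hu; have [_ Dv2 _] := Hv; have [_ Dphi2 _] := Hphi.
rewrite -[RHS]/(inner Omega _ _) innerBl//.
rewrite -(neumann_solutionE solu Hphi) -(neumann_solutionE solv Hphi).
rewrite -innerBl//; try exact: L2v_sigmaZ.
by apply: eq_Rintegral => x _; rewrite -scalerBr dotvZl.
Qed.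

Lemma inner_sigma_coercive F : L2v Omega F ->
  K1 * inner Omega F F <= inner Omega (fun x => sigma x *: F x) F.
Proof.
apply: inner_ae_coercive => //; first exact: normr_sigma_le.
by apply: filterS sigma_bounds => x /[apply] -[/ltW].
Qed.

(** The difference of two solutions solves the problem with zero right-hand side. Testing it with
    itself makes the weighted energy vanish, and coercivity gives a zero gradient. Only gradients
    are compared, since potentials are determined up to a constant. *)
Lemma neumann_solution_unique F u Du v Dv : L2v Omega F ->
  neumann_solution Omega sigma F u Du -> neumann_solution Omega sigma F v Dv ->
  {ae mu, forall x, Omega x -> Du x = Dv x}.
Proof.
move=> F2 solu solv; have solw := neumann_solutionB F2 F2 solu solv.
have [Hw _] := solw; have [_ Dw2 _] := Hw.
have := neumann_solutionE solw Hw; rewrite innerBl// subrr => w0.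
have : inner Omega (fun x => Du x - Dv x) (fun x => Du x - Dv x) = 0.
  apply/eqP; rewrite eq_le inner_ge0 andbT -(pmulr_rle0 _ K1_gt0).
  by rewrite -w0; exact: inner_sigma_coercive.
move/(inner_eq0_ae mOmega Dw2); apply: filterS => x /[apply] /eqP.
by rewrite subr_eq0 => /eqP.
Qed.

(** * Reconstruction of the current from the internal functional, and its stability *)

Variable beta : R.
Hypothesis beta_neq1 : beta <> 1.

Let beta1 : beta - 1 != 0. Proof. by rewrite subr_eq0; exact/eqP. Qed.

Lemma L2v_internal_functional Du J : L2v Omega Du -> L2v Omega J ->
  L2v Omega (internal_functional beta sigma Du J).
Proof.
move=> Du2 J2; apply: L2vB => //.
have -> : (fun x => (beta * sigma x) *: Du x) =
    (fun x => beta *: (sigma x *: Du x)).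
  by apply/funext => x; rewrite scalerA.
by apply: L2vZ => //; exact: L2v_sigmaZ.
Qed.

(** The weak form of div A = (beta - 1) div J: against a gradient, [J] can be replaced by
    [sigma Du]. *)
Lemma inner_internal_functional J u Du v Dv : L2v Omega J ->
  neumann_solution Omega sigma J u Du -> H1 Omega v Dv ->
  inner Omega (internal_functional beta sigma Du J) Dv =
  (beta - 1) * inner Omega (fun x => sigma x *: Du x) Dv.
Proof.
move=> J2 sol Hv; have [[_ Du2 _] _] := sol; have [_ Dv2 _] := Hv.
have sDu2 := L2v_sigmaZ Du2.
rewrite /internal_functional; under eq_fun do rewrite -scalerA.
rewrite innerBl//; last exact: L2vZ.
by rewrite innerZl// -(neumann_solutionE sol Hv) mulrBl mul1r.
Qed.

(** The potential [u] itself solves the reconstruction problem. Any other solution has the same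
    gradient almost everywhere, and the formula then undoes the definition of the functional. *)
Lemma reconstructed_from_internal_functional J u Du : L2v Omega J ->
  neumann_solution Omega sigma J u Du ->
  reconstructed_from Omega beta sigma (internal_functional beta sigma Du J) J.
Proof.
move=> J2 sol; have [Hu _] := sol; have [_ Du2 _] := Hu.
have A2 := L2v_internal_functional Du2 J2.
have solA : neumann_solution Omega sigma
    (fun x => (beta - 1)^-1 *: internal_functional beta sigma Du J x) u Du.
  split=> // phi Dphi Hphi; have [_ Dphi2 _] := Hphi.
  rewrite -[RHS]/(inner Omega _ _) innerZl//.
  rewrite (inner_internal_functional J2 sol Hphi) mulKf//.
  by apply: eq_Rintegral => x _; rewrite dotvZl.
split; first by exists u, Du.
move=> v Dv solv.
have := neumann_solution_unique (L2vZ mOmega _ A2) solA solv.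
apply: filterS => x /[apply] <-.
by rewrite /internal_functional opprB addrC subrK.
Qed.

Lemma current_stability J J' u u' Du Du' : L2v Omega J -> L2v Omega J' ->
  neumann_solution Omega sigma J u Du ->
  neumann_solution Omega sigma J' u' Du' ->
  0 < K2 ->
  normL2 Omega (fun x => J x - J' x) <=
  (1 + `|beta| * K2 / (`|beta - 1| * K1)) *
  normL2 Omega (fun x => internal_functional beta sigma Du J x
                         - internal_functional beta sigma Du' J' x).
Proof.
move=> J2 J'2 sol sol' K2_gt0.
have := neumann_solutionB J2 J'2 sol sol'.
set w := fun x => Du x - Du' x; set j := fun x => J x - J' x.
move=> solw; have [Hw _] := solw; have [_ w2 _] := Hw.
have j2 : L2v Omega j by exact: L2vB.
set a := fun x => _ - internal_functional _ _ _ _ x.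
(* The functional is linear in the pair (gradient, current), so [a] is the functional of the current
   [j], whose potential is [u - u']. *)
have aE : a = internal_functional beta sigma w j.
  apply/funext => x; rewrite /a /internal_functional /w /j scalerBr.
  by rewrite !opprD !opprK addrACA.
have a2 : L2v Omega a by rewrite aE; exact: L2v_internal_functional.
have sw2 := L2v_sigmaZ w2.
have w_le : normL2 Omega w <= normL2 Omega a / (`|beta - 1| * K1).
  have := inner_sigma_coercive w2.
  have := cauchy_schwarz mOmega a2 w2.
  rewrite [in X in X -> _]aE (inner_internal_functional j2 solw Hw) normrM.
  rewrite -aE -sqr_normL2 => csw cow.
  have b0 : 0 < `|beta - 1| by rewrite normr_gt0.
  rewrite ler_pdivlMr ?mulr_gt0//.
  (* Cauchy-Schwarz and coercivity bound the square of the norm of [w]; one factor is cancelled,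
     which requires it to be nonzero. *)
  have [->|w0] := eqVneq (normL2 Omega w) 0; first by rewrite mul0r normL2_ge0.
  have wp : 0 < normL2 Omega w by rewrite lt_neqAle eq_sym w0 normL2_ge0.
  rewrite -(ler_pM2r wp) (le_trans _ csw)//.
  rewrite [leLHS](_ : _ = `|beta - 1| * (K1 * normL2 Omega w ^+ 2)); last by ring.
  by rewrite ler_pM2l// (le_trans cow)// ler_norm.
have -> : j = (fun x => beta *: (sigma x *: w x) - a x).
  by apply/funext => x; rewrite aE /internal_functional scalerA opprB addrC subrK.
apply: (le_trans (normL2B_le mOmega (L2vZ mOmega beta sw2) a2)).
(* The norm of [a] cancels against the summand 1 of the constant. What remains is to bound the norm
   of [sigma w] by [K2] times the bound in [w_le]. *)
rewrite normL2Z// mulrDl mul1r addrC lerD2l -!mulrA ler_wpM2l//.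
apply: le_trans
  (normL2_ae_boundedZ mOmega (ltW K2_gt0) msigma normr_sigma_le w2) _.
by rewrite ler_pM2l// mulrC.
Qed.

End weighted.

End neumann.

Theorem theorem4 (R : realType) (n : nat) (hn : (2 <= n)%N)
  (Omega : set 'rV[R]_n)
  (Omega_open : open Omega) (Omega_neq0 : Omega !=set0)
  (Omega_connected : connected Omega) (Omega_bounded : bounded_set Omega)
  (Omega_sc : simply_connected Omega) (Omega_C2 : Ck_boundary 2 Omega)
  (sigma0 : 'rV[R]_n -> R) (K1 K2 : R) (sigma0_Loo : Loo Omega sigma0)
  (K1_gt0 : 0 < K1) (K2_gt0 : 0 < K2)
  (sigma0_bounds :
    {ae lebesgue_rV n, forall x, Omega x -> K1 < sigma0 x /\ sigma0 x < K2})
  (beta : R) (beta_neq1 : beta <> 1)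
  (J0 J0' : 'rV[R]_n -> 'rV[R]_n)
  (J0_L2 : L2v Omega J0) (J0_supp : compactly_supported Omega J0)
  (J0'_L2 : L2v Omega J0') (J0'_supp : compactly_supported Omega J0')
  (u0 u0' : 'rV[R]_n -> R) (Du0 Du0' : 'rV[R]_n -> 'rV[R]_n)
  (u0_potential : neumann_solution Omega sigma0 J0 u0 Du0)
  (u0'_potential : neumann_solution Omega sigma0 J0' u0' Du0') :
  let A := internal_functional beta sigma0 Du0 J0 in
  let A' := internal_functional beta sigma0 Du0' J0' in
  [/\ reconstructed_from Omega beta sigma0 A J0,
      reconstructed_from Omega beta sigma0 A' J0' &
      (L2v_norm Omega (J0 \- J0')%R <=
       (1 + `|beta| * K2 / (`|beta - 1| * K1))%:E *
       L2v_norm Omega (A \- A')%R)%E].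
Proof.
move=> A A'.
have mO := open_measurable_rV Omega_open.
(* Membership in L^oo concerns the zero extension of [sigma0]; its measurability is brought back to
   [Omega]. *)
have ms : measurable_fun Omega sigma0.
  apply/(measurable_restrictT sigma0 mO).
  by move: sigma0_Loo; rewrite /Loo inE => /andP[+ _]; rewrite inE.
have [[_ Du2 _] _] := u0_potential; have [[_ Du'2 _] _] := u0'_potential.
have A2 : L2v Omega A.
  exact: (L2v_internal_functional mO ms K1_gt0 sigma0_bounds).
have A'2 : L2v Omega A'.
  exact: (L2v_internal_functional mO ms K1_gt0 sigma0_bounds).
split.
- exact: (reconstructed_from_internal_functional mO Omega_bounded ms K1_gt0
    sigma0_bounds beta_neq1 J0_L2 u0_potential).
- exact: (reconstructed_from_internal_functional mO Omega_bounded ms K1_gt0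
    sigma0_bounds beta_neq1 J0'_L2 u0'_potential).
(* Both norms are finite, so the inequality between extended reals becomes one between reals. *)
rewrite (L2v_normE mO (L2vB mO J0_L2 J0'_L2)).
rewrite (L2v_normE mO (L2vB mO A2 A'2)) -EFinM lee_fin.
exact: (current_stability mO Omega_bounded ms K1_gt0 sigma0_bounds beta_neq1
  J0_L2 J0'_L2 u0_potential u0'_potential K2_gt0).
Qed.
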